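(* Let $E$ be a Banach space, let $A, B \in B(E)$, and let $M_{A,B} : B(E) \to B(E)$ be the elementary multiplication operator defined by $M_{A,B}(X) = AXB$ for all $X \in B(E)$. Then $M_{A,B}$ is nilpotent if and only if either $A$ or $B$ is nilpotent.
   Context: For a Banach space $E$ (over $\mathbb{R}$ or $\mathbb{C}$), $B(E)$ denotes the algebra of all bounded linear operators on $E$. An operator $T$ (on $E$, or on $B(E)$) is nilpotent if $T^k = 0$ for some positive integer $k$; for an operator on $B(E)$, powers are taken with respect to composition. ''Either ... or'' is inclusive. *)

(* Defs.v *)
From HB Require Import structures.
From mathcomp Require Import all_boot all_order all_algebra.
From mathcomp Require Export complex.
From mathcomp Require Import all_classical all_reals all_analysis.

Set Implicit Arguments.
Unset Strict Implicit.
Unset Printing Implicit Defensive.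

Import Order.TTheory GRing.Theory Num.Theory.
Import numFieldNormedType.Exports.

Local Open Scope ring_scope.

Section BoundedOperators.
Variables (K : numFieldType) (E : normedModType K).

Definition bounded_operator : {pred E -> E} :=
  [pred f | `[< linear f /\ exists M : K, forall x, `|f x| <= M * `|x| >]].

(* The norm of [E] takes its values in [K] itself, so [M] is a scalar; for
   [K = R[i]], [`|f x| <= M * `|x|] with [x != 0] forces [M] to be real and
   nonnegative. *)
Lemma bounded_operatorP (f : E -> E) : reflect
  (linear f /\ exists2 M : K, 0 <= M & forall x, `|f x| <= M * `|x|)
  (f \in bounded_operator).
Proof.
apply: (iffP (asboolP _)) => -[lf] => [[M Mf]|[M _ Mf]]; split=> //; last by exists M.
exists `|M| => // x; rewrite -(normr_id x) -normrM.
have M0 : 0 <= M * `|x| by apply: le_trans (Mf x).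
by rewrite ger0_norm.
Qed.

Lemma bounded_operator_submod : submod_closed bounded_operator.
Proof.
split=> [|a f g /bounded_operatorP[lf [M M0 Mf]] /bounded_operatorP[lg [N N0 Ng]]].
  apply/bounded_operatorP; split=> [b x y|].
    by rewrite /GRing.zero /= scaler0 addr0.
  by exists 0 => // x; rewrite normr0 mul0r.
apply/bounded_operatorP; split=> [b x y|].
  rewrite !fctE lf lg !scalerDr !scalerA [b * a]mulrC -!addrA; congr (_ + _).
  by rewrite addrCA.
exists (`|a| * M + N) => [|x]; first by rewrite addr_ge0 ?mulr_ge0.
rewrite !fctE mulrDl (le_trans (ler_normD _ _))// lerD// normrZ -mulrA.
by rewrite ler_wpM2l.
Qed.

HB.instance Definition _ :=
  GRing.isSubmodClosed.Build K (E -> E) bounded_operator bounded_operator_submod.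

Record bop := Bop { bop_fun :> E -> E; _ : bop_fun \in bounded_operator }.

HB.instance Definition _ := [isSub for bop_fun].
HB.instance Definition _ := [Choice of bop by <:].
HB.instance Definition _ := [SubChoice_isSubLmodule of bop by <:].

Lemma bopP (f : bop) :
  linear f /\ exists2 M : K, 0 <= M & forall x, `|f x| <= M * `|x|.
Proof. by apply/bounded_operatorP; case: f. Qed.

HB.instance Definition _ (f : bop) := GRing.isLinear.Build K E E *:%R f (bopP f).1.

Lemma bopD (f g : bop) x : (f + g) x = f x + g x. Proof. by []. Qed.
Lemma bopZ a (f : bop) x : (a *: f) x = a *: f x. Proof. by []. Qed.
Lemma bop0 x : (0 : bop) x = 0. Proof. by []. Qed.

Lemma bop_ext (f g : bop) : f =1 g -> f = g.
Proof. by move=> fg; apply: val_inj; apply: funext. Qed.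

Fact id_bounded : idfun \in bounded_operator.
Proof.
by apply/bounded_operatorP; split=> //; exists 1 => // x; rewrite mul1r.
Qed.

Fact comp_bounded (f g : bop) : f \o g \in bounded_operator.
Proof.
apply/bounded_operatorP; split=> [a x y|]; first by rewrite /= !linearP.
have [_ [M M0 Mf]] := bopP f; have [_ [N N0 Ng]] := bopP g.
exists (M * N) => [|x]; first exact: mulr_ge0.
by rewrite (le_trans (Mf _))// -mulrA ler_wpM2l.
Qed.

Definition bop_id := Bop id_bounded.
Definition bop_comp (f g : bop) := Bop (comp_bounded f g).

Fact bop_compA : associative bop_comp.
Proof. by move=> f g h; apply: bop_ext. Qed.
Fact bop_comp1l : left_id bop_id bop_comp.
Proof. by move=> f; apply: bop_ext. Qed.
Fact bop_comp1r : right_id bop_id bop_comp.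
Proof. by move=> f; apply: bop_ext. Qed.
Fact bop_compDl : left_distributive bop_comp +%R.
Proof. by move=> f g h; apply: bop_ext. Qed.
Fact bop_compDr : right_distributive bop_comp +%R.
Proof. by move=> f g h; apply: bop_ext => x; exact: linearD. Qed.

(* [E] may be the zero space, in which case [1 = 0] here. This is why the ring
   is only a pzRingType, and why the two algebra laws below are plain lemmas:
   algType requires [1 != 0]. *)
HB.instance Definition _ := GRing.Zmodule_isPzRing.Build bop
  bop_compA bop_comp1l bop_comp1r bop_compDl bop_compDr.

Fact bop_scalerAl (a : K) (f g : bop) : a *: (f * g) = a *: f * g.
Proof. exact: bop_ext. Qed.
Fact bop_scalerAr (a : K) (f g : bop) : a *: (f * g) = f * (a *: g).
Proof. by apply: bop_ext => x; rewrite bopZ /= linearZ. Qed.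

Lemma bopM (f g : bop) x : (f * g) x = f (g x). Proof. by []. Qed.

Definition mul_op (A B : bop) : bop -> bop := fun X => A * X * B.

Fact mul_op_linear (A B : bop) : linear (mul_op A B).
Proof.
by move=> a X Y; rewrite /mul_op mulrDr mulrDl -bop_scalerAr -bop_scalerAl.
Qed.
HB.instance Definition _ (A B : bop) :=
  GRing.isLinear.Build K bop bop *:%R (mul_op A B) (mul_op_linear A B).

End BoundedOperators.

Notation "''B' ( E )" := (bop E) (at level 8, format "''B' ( E )") : type_scope.

Definition nilpotent_op (V : nmodType) (T : V -> V) : Prop :=
  exists2 k, (0 < k)%N & forall v, iter k T v = 0.

Lemma iter_bop (K : numFieldType) (E : normedModType K) (A : 'B(E)) k x :
  iter k A x = (A ^+ k) x.
Proof. by elim: k => //= k ->; rewrite exprS. Qed.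

Lemma nilpotent_bopE (K : numFieldType) (E : normedModType K) (A : 'B(E)) :
  nilpotent_op A <-> exists2 k, (0 < k)%N & A ^+ k = 0.
Proof.
split=> -[k k0 Ak]; exists k => //; last by move=> x; rewrite iter_bop Ak.
by apply: bop_ext => x; rewrite -iter_bop Ak.
Qed.

(* Main.v *)
Require Import Defs.
From mathcomp Require Import all_boot all_order all_algebra.
From mathcomp Require Import all_classical all_reals all_analysis.
From HB Require Import structures.
From mathcomp Require Import ring lra.

(** If [A ^+ k] and [B ^+ k] are both nonzero, choose [x] and [z] with
    [y := (B ^+ k) x != 0] and [(A ^+ k) z != 0], and by Hahn-Banach a bounded
    functional [phi] with [phi y != 0]. The rank-one operator
    [X := phi(.) *: z] then satisfies [(A ^+ k * X * B ^+ k) x != 0].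
    Hahn-Banach is obtained from the fact that a sublinear functional which is
    minimal for the pointwise order is linear. *)

Set Implicit Arguments.
Unset Strict Implicit.
Unset Printing Implicit Defensive.

Import Order.TTheory GRing.Theory Num.Theory.
Import numFieldNormedType.Exports.

Local Open Scope classical_set_scope.
Local Open Scope ring_scope.

(** * Sublinear functionals and the Hahn-Banach theorem *)

Section Sublinear.
Variables (R : realType) (V : lmodType R).

Definition sublinear (q : V -> R) : Prop :=
  (forall x y, q (x + y) <= q x + q y) /\
  (forall t x, 0 <= t -> q (t *: x) <= t * q x).

(** For [t > 0] the missing inequality comes from scaling [t *: x] by [t^-1]; for [t = 0] it is
    [0 <= q 0], from [q (0 + 0) <= q 0 + q 0]. *)
Lemma sublinearZ (q : V -> R) t x :
  sublinear q -> 0 <= t -> q (t *: x) = t * q x.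
Proof.
move=> [qD qZ]; rewrite le_eqVlt => /predU1P[<-|t0].
  rewrite scale0r mul0r; apply/eqP; rewrite eq_le; apply/andP; split.
    by have := qZ 0 0 (lexx _); rewrite scale0r mul0r.
  by have := qD 0 0; rewrite addr0; lra.
apply/eqP; rewrite eq_le (qZ _ _ (ltW t0))/=.
have tV0 : 0 <= t^-1 by rewrite invr_ge0 ltW.
have := qZ _ (t *: x) tV0; rewrite scalerA mulVf ?gt_eqF// scale1r.
by rewrite ler_pdivlMl.
Qed.

Lemma sublinear0 (q : V -> R) : sublinear q -> q 0 = 0.
Proof. by move=> sq; rewrite -(scale0r 0) sublinearZ// mul0r. Qed.

Lemma sublinearN (q : V -> R) x : sublinear q -> - q (- x) <= q x.
Proof.
by move=> sq; have := sq.1 x (- x); rewrite subrr sublinear0//; lra.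
Qed.

(** [inf] is a genuine infimum only on nonempty sets bounded below, whence [F0] and [Fb] in what
    follows. *)
Definition pointwise_inf (F : set (V -> R)) (x : V) : R :=
  inf [set f x | f in F].

Section PointwiseInf.
Variables (F : set (V -> R)) (b : V -> R).
Hypotheses (F0 : F !=set0) (Fb : forall f x, F f -> b x <= f x).

Lemma pointwise_inf_le f x : F f -> pointwise_inf F x <= f x.
Proof.
move=> Ff; apply: ge_inf; last by exists f.
by exists (b x) => _ [g Fg <-]; exact: Fb.
Qed.

Lemma le_pointwise_inf c x :
  (forall f, F f -> c <= f x) -> c <= pointwise_inf F x.
Proof.
move=> cF; apply: lb_le_inf; last by move=> _ [f Ff <-]; exact: cF.
by case: F0 => f Ff; exists (f x); exists f.
Qed.

(** Since [h] may depend on [f] and [g], the bound [h (x + y) <= f x + g y] survives taking the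
    infima over [f] and [g] separately. This covers both chains and families of translates. *)
Lemma sublinear_pointwise_inf :
  (forall f g, F f -> F g ->
     exists2 h, F h & forall x y, h (x + y) <= f x + g y) ->
  (forall t f, 0 <= t -> F f ->
     exists2 h, F h & forall x, h (t *: x) <= t * f x) ->
  sublinear (pointwise_inf F).
Proof.
move=> FD FZ; split=> [x y|t x t0].
  rewrite -lerBlDr; apply: le_pointwise_inf => f Ff.
  rewrite lerBlDr -lerBlDl; apply: le_pointwise_inf => g Fg.
  have [h Fh hfg] := FD f g Ff Fg.
  by rewrite lerBlDl (le_trans (pointwise_inf_le _ Fh)).
have [f Ff] := F0.
move: t0; rewrite le_eqVlt => /predU1P[<-|t0].
  have [h Fh hf] := FZ 0 f (lexx _) Ff.
  by rewrite mul0r (le_trans (pointwise_inf_le _ Fh))// -[leRHS](mul0r (f x)).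
rewrite -ler_pdivrMl//; apply: le_pointwise_inf => g Fg.
have [h Fh hg] := FZ t g (ltW t0) Fg.
by rewrite ler_pdivrMl// (le_trans (pointwise_inf_le _ Fh)).
Qed.

End PointwiseInf.

Definition translates (q : V -> R) (y : V) : set (V -> R) :=
  [set f | exists2 t, 0 <= t & f = fun x => q (x + t *: y) - t * q y].

(* A sublinear minorant of [q] with [improve q y x <= q (x + y) - q y]: when
   [q] is minimal it equals [q], whence [q x + q y <= q (x + y)]. *)
Definition improve (q : V -> R) (y : V) : V -> R :=
  pointwise_inf (translates q y).

Section Improve.
Variables (q : V -> R) (y : V).
Hypothesis sq : sublinear q.

(** Indeed [t * q y = q (t *: y) <= q (x + t *: y) + q (- x)]; the bound does not depend on [t]. *)
Let translates_ge f x : translates q y f -> - q (- x) <= f x.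
Proof.
move=> [t t0 ->]; rewrite -sublinearZ//.
by have := sq.1 (x + t *: y) (- x); rewrite addrAC subrr add0r; lra.
Qed.

Let translates_neq0 : translates q y !=set0.
Proof. by exists (fun x => q (x + 0 *: y) - 0 * q y); exists 0. Qed.

Lemma improve_le t x : 0 <= t -> improve q y x <= q (x + t *: y) - t * q y.
Proof.
move=> t0; pose f x := q (x + t *: y) - t * q y.
by apply: (pointwise_inf_le translates_ge (f := f)); exists t.
Qed.

Lemma improve_le_id x : improve q y x <= q x.
Proof. by have := improve_le x (lexx 0); rewrite scale0r mul0r addr0 subr0. Qed.

Lemma sublinear_improve : sublinear (improve q y).
Proof.
apply: (sublinear_pointwise_inf translates_neq0 translates_ge).
  (* Parameters add under sums of arguments, and scaling by [s] turns [t] into [s * t]. *)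
  move=> _ _ [s s0 ->] [t t0 ->].
  exists (fun x => q (x + (s + t) *: y) - (s + t) * q y).
    by exists (s + t); rewrite ?addr_ge0.
  move=> x z; rewrite scalerDl addrACA.
  by have := sq.1 (x + s *: y) (z + t *: y); lra.
move=> s _ s0 [t t0 ->].
exists (fun x => q (x + (s * t) *: y) - (s * t) * q y).
  by exists (s * t); rewrite ?mulr_ge0.
by move=> x; rewrite -scalerA -scalerDr sublinearZ// mulrBr mulrA.
Qed.

End Improve.

(** Minimality against [improve q y], taken at [t = 1], makes [q] superadditive, hence additive and
    odd; oddness extends homogeneity to negative scalars. *)
Lemma minimal_sublinear_linear (q : V -> R) : sublinear q ->
  (forall q', sublinear q' -> (forall x, q' x <= q x) ->
     forall x, q x <= q' x) ->
  scalar q.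
Proof.
move=> sq qmin.
have qD x y : q (x + y) = q x + q y.
  apply/eqP; rewrite eq_le sq.1/=.
  have := qmin _ (sublinear_improve y sq) (improve_le_id y sq) x.
  move/le_trans => /(_ _ (improve_le y sq x ler01)).
  by rewrite scale1r mul1r lerBrDr.
have qN x : q (- x) = - q x.
  by apply/eqP; rewrite -addr_eq0 -qD addrC subrr sublinear0.
move=> a x y; rewrite qD; congr (_ + _).
have [a0|a0] := leP 0 a; first exact: sublinearZ.
rewrite -[a]opprK scaleNr qN mulNr; congr (- _).
by rewrite sublinearZ// oppr_ge0 ltW.
Qed.

(** Zorn's lemma on the sublinear minorants of [p]: a nonempty chain is bounded by its pointwise
    infimum, finite because each minorant [g] satisfies [- p (- x) <= - g (- x) <= g x]. *)
Lemma minimal_sublinear_exists (p : V -> R) : sublinear p ->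
  exists q, [/\ sublinear q, forall x, q x <= p x &
    forall q', sublinear q' -> (forall x, q' x <= q x) ->
      forall x, q x <= q' x].
Proof.
move=> sp.
pose T := {q : V -> R | sublinear q /\ forall x, q x <= p x}.
(* The order is reversed, so a maximal element is a minimal functional. *)
pose rT (a b : T) := `[< forall x, sval b x <= sval a x >].
have t0 : T by exists p.
have [||A Atot|[q [sq qp]] qmax] := @ZL_preorder T t0 rT.
- by move=> t; apply/asboolP.
- move=> r s t /asboolP rs /asboolP st; apply/asboolP => x.
  exact: le_trans (st x) (rs x).
- have [A0|/set0P[a Aa]] := eqVneq A set0.
    by exists t0 => s; rewrite A0.
  pose F := [set sval s | s in A].
  have F0 : F !=set0 by exists (sval a); exists a.
  have Fb f x : F f -> - p (- x) <= f x.
    move=> [[g [sg gp]] _ <-] /=.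
    by apply: le_trans (sublinearN _ sg); rewrite lerN2.
  have sF : sublinear (pointwise_inf F).
    apply: (sublinear_pointwise_inf F0 Fb).
      move=> _ _ [f Af <-] [g Ag <-].
      (* The smaller of the two comparable functionals serves as [h]. *)
      have [/asboolP fg|/asboolP gf] := Atot _ _ Af Ag.
        exists (sval g) => [|x y]; first by exists g.
        by rewrite (le_trans ((svalP g).1.1 _ _))// lerD2r.
      exists (sval f) => [|x y]; first by exists f.
      by rewrite (le_trans ((svalP f).1.1 _ _))// lerD2l.
    move=> t _ t0' [f Af <-]; exists (sval f) => [|x]; first by exists f.
    exact: (svalP f).1.2.
  have Fp x : pointwise_inf F x <= p x.
    apply: le_trans ((svalP a).2 x).
    by apply: (pointwise_inf_le Fb); exists a.
  have sFp := conj sF Fp; exists (exist _ (pointwise_inf F) sFp : T) => s As; apply/asboolP => x /=.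
  by apply: (pointwise_inf_le Fb); exists s.
exists q; split=> // q' sq' q'q.
have q'p x : q' x <= p x by exact: le_trans (q'q x) (qp x).
by have /asboolP := qmax (exist _ q' (conj sq' q'p) : T) (introT (asboolP _) q'q).
Qed.

(** A minimal functional below [improve p y], rather than merely below [p], satisfies
    [f (- y) <= p (- y + y) - p y = - p y]. *)
Lemma hahn_banach_sublinear (p : V -> R) (y : V) : sublinear p ->
  exists f : V -> R, [/\ scalar f, forall x, f x <= p x & p y <= f y].
Proof.
move=> sp.
have [f [sf fp fmin]] := minimal_sublinear_exists (sublinear_improve y sp).
have lf := minimal_sublinear_linear sf fmin.
exists f; split=> // [x|]; first exact: le_trans (fp x) (improve_le_id y sp x).
have f0 := sublinear0 sf.
have := le_trans (fp (- y)) (improve_le y sp (- y) ler01).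
rewrite scale1r addNr sublinear0// mul1r sub0r.
by have := lf (-1) y 0; rewrite scaleN1r f0 !addr0 => ->; rewrite mulN1r lerN2.
Qed.

End Sublinear.

(** * Bounded functionals separate points, over the reals and the complex numbers *)

Definition dual_separates (K : numFieldType) (E : normedModType K) : Prop :=
  forall y : E, y != 0 -> exists phi : E -> K,
    [/\ scalar phi, exists M, forall x, `|phi x| <= M * `|x| & phi y != 0].

Lemma dual_separates_real (R : realType) (E : normedModType R) :
  dual_separates E.
Proof.
move=> y y0.
have sn : sublinear (fun x : E => `|x|).
  by split=> [x z|t x t0]; rewrite ?ler_normD// normrZ ger0_norm.
have [f [lf fn fy]] := hahn_banach_sublinear y sn.
exists f; split=> //.
  exists 1 => x; rewrite mul1r ler_norml fn andbT.
  have f0 : f 0 = 0 by have := lf (-1) 0 0; rewrite scaler0 addr0 mulN1r addNr.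
  have := fn (- x); have := lf (-1) x 0.
  by rewrite scaleN1r addr0 f0 normrN => ->; lra.
by rewrite gt_eqF// (lt_le_trans _ fy)// normr_gt0.
Qed.

(** A type alias, so that the real scalar action does not clash with the complex one on [E]. *)
Definition realification (R : rcfType) (E : lmodType R[i]) : Type := E.

Section Realification.
Variables (R : rcfType) (E : lmodType R[i]).

HB.instance Definition _ := GRing.Zmodule.on (realification E).

Let rscale (a : R) (x : realification E) : realification E :=
  real_complex R a *: (x : E).

Let rscaleA a b x : rscale a (rscale b x) = rscale (a * b) x.
Proof. by rewrite /rscale scalerA -rmorphM. Qed.

Let rscale1 : left_id 1 rscale.
Proof. by move=> x; rewrite /rscale rmorph1 scale1r. Qed.

Let rscaleDr : right_distributive rscale +%R.
Proof. by move=> a x y; rewrite /rscale scalerDr. Qed.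

Let rscaleDl x : {morph rscale^~ x : a b / a + b}.
Proof. by move=> a b; rewrite /rscale rmorphD scalerDl. Qed.

HB.instance Definition _ := GRing.Zmodule_isLmodule.Build R (realification E)
  rscaleA rscale1 rscaleDr rscaleDl.

Lemma realificationZ (a : R) (x : realification E) :
  a *: x = real_complex R a *: (x : E).
Proof. by []. Qed.

End Realification.

(* The complex-linear functional whose real part is [f]. *)
Definition complexify (R : rcfType) (E : lmodType R[i]) (f : E -> R) (x : E) :
  R[i] := (f x -i* f ('i%C *: x))%C.

(** For a scalar [a +i* b], the imaginary part evaluates [f] at [(- b +i* a) *: x], since
    ['i * (a +i* b) = - b +i* a]. *)
Lemma complexify_linear (R : rcfType) (E : lmodType R[i]) (f : E -> R) :
  scalar (f : realification E -> R) -> scalar (complexify f).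
Proof.
move=> lf.
have fD x y : f (x + y) = f x + f y.
  by have := lf 1 x y; rewrite scale1r mul1r.
have f0 : f 0 = 0 by have := fD 0 0; rewrite addr0; lra.
have fZ (a : R) x : f (real_complex R a *: x) = a * f x.
  by have := lf a x 0; rewrite realificationZ !addr0 f0 addr0.
have fZi (a b : R) x : f ((a +i* b)%C *: x) = a * f x + b * f ('i%C *: x).
  by rewrite [(a +i* b)%C]complexE/= scalerDl fD mulrC -scalerA !fZ.
move=> [a b] x y; rewrite /complexify scalerDr !fD scalerA.
have -> : 'i%C * (a +i* b)%C = (- b +i* a)%C :> R[i] by simpc.
by rewrite (fZi a) (fZi (- b)); apply/eqP; rewrite eq_complex /=; apply/andP; split;
  apply/eqP; ring.
Qed.

Lemma norm_complex_le (R : rcfType) (a b : R) :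
  `|(a +i* b)%C| <= real_complex R (`|a| + `|b|).
Proof.
have nr (c : R) : `|real_complex R c| = real_complex R `|c|.
  by rewrite normc_def /= expr0n addr0 sqrtr_sqr.
rewrite [(a +i* b)%C]complexE/= (le_trans (ler_normD _ _))// normrM !nr.
by rewrite [`|'i%C|]normc_def/= expr0n expr1n add0r sqrtr1 mul1r rmorphD.
Qed.

Lemma dual_separates_complex (R : realType) (E : normedModType R[i]) :
  dual_separates E.
Proof.
move=> y y0.
have nE (x : E) : `|x| = real_complex R (complex.Re `|x|).
  by rewrite RRe_real// normr_real.
(* The norm is [R[i]]-valued; its real part is the real sublinear functional to dominate by. *)
pose n (x : realification E) : R := complex.Re `|x : E|.
have sn : sublinear n.
  split=> [x z|t x t0].
    by rewrite -lecR rmorphD /= -!nE; exact: (@ler_normD _ E).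
  by rewrite -lecR rmorphM /= -!nE realificationZ normrZ ger0_norm ?ler0c// lexx.
have nN x : n (- x) = n x by rewrite /n normrN.
have ni x : n ('i%C *: (x : E)) = n x.
  by rewrite /n normrZ normc_def /= expr0n expr1n add0r sqrtr1 mul1r.
have [f [lf fn fy]] := hahn_banach_sublinear (y : realification E) sn.
have abs_f x : `|f x| <= n x.
  rewrite ler_norml fn andbT.
  have f0 : f 0 = 0 by have := lf (-1) 0 0; rewrite scaler0 addr0 mulN1r addNr.
  have := fn (- x); have := lf (-1) x 0.
  by rewrite scaleN1r addr0 f0 nN => ->; lra.
exists (complexify f); split.
- exact: complexify_linear.
(* The constant 2 comes from [|f x| + |f ('i *: x)| <= n x + n ('i *: x) = 2 * n x]. *)
- exists 2 => x; rewrite (le_trans (norm_complex_le _ _))// normrN nE.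
  rewrite -[2](rmorph_nat (real_complex R)) -rmorphM /= lecR mulr_natl mulr2n.
  by rewrite lerD ?abs_f// -[leRHS]ni abs_f.
- apply: contraTneq fy => -[fy0 _]; rewrite fy0 -ltNge -ltcR -nE.
  by rewrite normr_gt0.
Qed.

(** * Rank-one operators and nilpotency of the multiplication operator *)

Section RankOne.
Variables (K : numFieldType) (E : normedModType K) (phi : E -> K) (z : E).
Hypotheses (phi_lin : scalar phi)
  (phi_bnd : exists M, forall x, `|phi x| <= M * `|x|).

Lemma rank_one_bounded : (fun x => phi x *: z) \in @bounded_operator K E.
Proof.
apply/asboolP; split=> [a x y|]; first by rewrite phi_lin scalerDl scalerA.
have [M phiM] := phi_bnd; exists (M * `|z|) => x.
by rewrite normrZ mulrAC ler_wpM2r.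
Qed.

Definition rank_one : 'B(E) := Bop rank_one_bounded.

End RankOne.

Lemma iter_mul_op (K : numFieldType) (E : normedModType K) (A B X : 'B(E)) k :
  iter k (mul_op A B) X = A ^+ k * X * B ^+ k.
Proof.
elim: k => [|k IHk]; first by rewrite !expr0 mul1r mulr1.
by rewrite iterS IHk /mul_op exprS exprSr !mulrA.
Qed.

(** This is primeness of the ring ['B(E)]. *)
Lemma mul_op_eq0 (K : numFieldType) (E : normedModType K) (A B : 'B(E)) :
  dual_separates E -> (forall X, A * X * B = 0) -> A = 0 \/ B = 0.
Proof.
move=> sepE AXB; have [->|/eqP B0] := pselect (B = 0); [by right|left].
apply: bop_ext => z; rewrite bop0.
have [x Bx0] : exists x, B x != 0.
  apply: contrapT => /forallNP Bx; case/eqP: B0; apply: bop_ext => x.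
  by have /negP := Bx x; rewrite negbK => /eqP.
have [phi [phi_lin phi_bnd phiB]] := sepE _ Bx0.
(* With [X] of rank one, [(A * X * B) x = phi (B x) *: A z], and [z] is arbitrary. *)
have := congr1 (fun T : 'B(E) => T x) (AXB (rank_one z phi_lin phi_bnd)).
rewrite /= linearZ => /eqP.
by rewrite scaler_eq0 (negPf phiB) => /eqP.
Qed.

(** The same exponent [k] serves in both directions. Only [dual_separates] depends on the scalar
    field, so the real and complex cases share this argument. *)
Lemma nilpotent_mul_op (K : numFieldType) (E : normedModType K)
    (A B : 'B(E)) : dual_separates E ->
  nilpotent_op (mul_op A B) <-> nilpotent_op A \/ nilpotent_op B.
Proof.
move=> sepE; rewrite !nilpotent_bopE; split.
  move=> [k k0 Mk].
  have [X|Ak|Bk] := @mul_op_eq0 _ _ (A ^+ k) (B ^+ k) sepE.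
  - by rewrite -iter_mul_op Mk.
  - by left; exists k.
  - by right; exists k.
by case=> -[k k0 Nk]; exists k => // X; rewrite iter_mul_op Nk ?mul0r ?mulr0.
Qed.

Theorem theorem2p1 (R : realType) :
  (forall (E : completeNormedModType R) (A B : 'B(E)),
     nilpotent_op (mul_op A B) <-> nilpotent_op A \/ nilpotent_op B) /\
  (forall (E : completeNormedModType R[i]) (A B : 'B(E)),
     nilpotent_op (mul_op A B) <-> nilpotent_op A \/ nilpotent_op B).
Proof.
split=> E A B; apply: nilpotent_mul_op.
  exact: dual_separates_real.
exact: dual_separates_complex.
Qed.
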